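(* Let $\mathbf G$ be a linear algebraic group over $\mathbb R$, not necessarily connected or reductive, let $G=\mathbf G(\mathbb C)$, and let $\sigma\colon G\to G$ be the action of complex conjugation on $G$. Let $G^0$ be the identity component of $G$, let $G^{\mathrm f}=G/G^0$ be the (finite) component group with its induced action $\sigma$, and let $\pi\colon G\to G^{\mathrm f}$ be the canonical epimorphism. Let $g_1^{\mathrm f}=1,g_2^{\mathrm f},\dots,g_k^{\mathrm f}\in Z^1(G^{\mathrm f},\sigma)$ be $1$-cocycles representing all cohomology classes in $H^1(G^{\mathrm f},\sigma)$, exactly one for each class. For each $i$ choose a lift $h_i\in G$ of $g_i^{\mathrm f}$ (that is, $\pi(h_i)=g_i^{\mathrm f}$), and set $a_i=h_i\,\sigma(h_i)\in G^0$ and $f_i\colon G^0\to G^0$, $f_i(x)=h_i\,\sigma(x)\,h_i^{-1}$. Let $I$ be the set of those indices $i$ for which there exists $s\in G^0$ with $s\cdot f_i(s)\cdot a_i=1$. For each $i\in I$ choose such an element $s=s_i$ and set $g_i=s_ih_i$; then $g_i\in Z^1(G,\sigma)$ and $\pi(g_i)=g_i^{\mathrm f}$. Set $\sigma_i(x)=g_i\,\sigma(x)\,g_i^{-1}$ for $x\in G$; this is an involution of $G$ preserving $G^0$ and inducing an involution, again denoted $\sigma_i$, of $G^{\mathrm f}$. Let $X_i\subset Z^1(G^0,\sigma_i)$ be a set containing exactly one representative of each class in $H^1(G^0,\sigma_i)$. The finite group $(G^{\mathrm f})^{\sigma_i}$ of fixed points acts on the right on $H^1(G^0,\sigma_i)$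 by $[x]*b^{\mathrm f}=[\,b^{-1}x\,\sigma_i(b)\,]$, where $b\in G$ is any lift of $b^{\mathrm f}$, and hence acts on $X_i$. Let $X_i^{\#}\subseteq X_i$ be a set containing exactly one element of each orbit of $(G^{\mathrm f})^{\sigma_i}$ in $X_i$. Then the union $$\mathfrak X=\bigcup_{i\in I}X_i^{\#}\,g_i$$ is contained in $Z^1(G,\sigma)$ and is a set of representatives of all cohomology classes in $H^1(\mathbb R,\mathbf G)=H^1(G,\sigma)$, with exactly one element in each class.
   Context: For a group $A$ with an involutive automorphism $\tau$ (i.e. an action of the group $\Gamma=\mathrm{Gal}(\mathbb C/\mathbb R)=\{1,\gamma\}$ of order $2$ with $\gamma$ acting as $\tau$), set $Z^1(A,\tau)=\{a\in A\mid a\cdot\tau(a)=1\}$, whose elements are called $1$-cocycles. Two $1$-cocycles $a_1,a_2$ are equivalent if $a_2=a'\cdot a_1\cdot\tau(a')^{-1}$ for some $a'\in A$. $H^1(A,\tau)$ is the set of equivalence classes, and $[a]$ denotes the class of $a$. For a linear algebraic $\mathbb R$-group $\mathbf G$, the group $\mathbf G(\mathbb C)$ carries the involution $\sigma$ given by complex conjugation, and $H^1(\mathbb R,\mathbf G)=H^1(\mathbf G(\mathbb C),\sigma)$. For $Y\subset G$ and $g\in G$, $Yg=\{yg\mid y\in Y\}$. *)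

(* Defs.v *)
From HB Require Import structures.
From mathcomp Require mpoly.
Import -(notations) mpoly.
From mathcomp Require Import all_boot all_order all_algebra generic_quotient.
From mathcomp Require Import complex.
From mathcomp Require Import boolp classical_sets functions reals topology.

Set Implicit Arguments.
Unset Strict Implicit.
Unset Printing Implicit Defensive.

Import GRing.Theory.

Local Open Scope classical_set_scope.
Local Open Scope group_scope.

(* H^1 of the group of order two acting by tau on a subgroup A, stable under   *)
(* tau, of an ambient group G.                                                 *)
Section Cohomology.
Variables (G : groupType) (A : set G) (tau : G -> G).

Definition Z1 : set G := [set a | A a /\ a * tau a = 1].

Definition cocycle_class (a : G) : set G :=
  [set b | exists2 c, A c & b = c * a * (tau c)^-1].

Definition H1 : set (set G) := [set cocycle_class a | a in Z1].

Definition represents_H1 (X : set G) : Prop :=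
  X `<=` Z1 /\ set_bij X H1 cocycle_class.

End Cohomology.

Record normalSubgroup (G : groupType) := NormalSubgroup {
  normal_set :> set G;
  normal1 : normal_set 1;
  normalVM : forall x y, normal_set x -> normal_set y ->
    normal_set (x^-1 * y);
  normalJ : forall x y, normal_set x -> normal_set (y^-1 * x * y)
}.

Section Quotient.
Variables (G : groupType) (N : normalSubgroup G).

Definition same_coset : rel G := fun x y => `[< normal_set N (x^-1 * y) >].

Lemma same_cosetP x y : reflect (normal_set N (x^-1 * y)) (same_coset x y).
Proof. exact: asboolP. Qed.

Lemma normalV x : normal_set N x -> normal_set N x^-1.
Proof. by move=> Nx; have := normalVM Nx (normal1 N); rewrite mulg1. Qed.

Lemma normalM x y : normal_set N x -> normal_set N y -> normal_set N (x * y).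
Proof. by move=> /normalV Nx Ny; have := normalVM Nx Ny; rewrite invgK. Qed.

Lemma same_coset_refl : reflexive same_coset.
Proof. by move=> x; apply/same_cosetP; rewrite mulVg; exact: normal1. Qed.

Lemma same_coset_sym : symmetric same_coset.
Proof.
suff S x y : same_coset x y -> same_coset y x by move=> x y; apply/idP/idP; exact: S.
by move=> /same_cosetP/normalV Nxy; apply/same_cosetP; move: Nxy; rewrite invgM invgK.
Qed.

Lemma same_coset_trans : transitive same_coset.
Proof.
move=> y x z /same_cosetP Nxy /same_cosetP Nyz; apply/same_cosetP.
by have := normalM Nxy Nyz; rewrite mulgA mulgK.
Qed.

Canonical same_coset_equiv :=
  EquivRel same_coset same_coset_refl same_coset_sym same_coset_trans.

Definition quot_group := {eq_quot same_coset}%qT.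

HB.instance Definition _ := Choice.on quot_group.
HB.instance Definition _ := EqQuotient.on quot_group.

Definition quot_pi (x : G) : quot_group := (\pi_quot_group x)%qT.

Lemma quot_piP x y : quot_pi x = quot_pi y <-> normal_set N (x^-1 * y).
Proof.
split=> [/eqmodP/same_cosetP //|Nxy].
by apply/eqmodP/same_cosetP.
Qed.

(* The self-map of G / N induced by phi, meant for maps phi sending cosets of N *)
(* into cosets of N; see quot_mapE.                                             *)
Definition quot_map (phi : G -> G) (y : quot_group) : quot_group :=
  quot_pi (phi (repr y)).

Lemma quot_reprK y : quot_pi (repr y) = y.
Proof. exact: reprK. Qed.

Lemma quot_mapE (phi : G -> G) :
    {morph phi : x y / x * y} ->
    (forall x, normal_set N x -> normal_set N (phi x)) ->
  forall x, quot_map phi (quot_pi x) = quot_pi (phi x).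
Proof.
move=> phiM phiN x; apply/quot_piP.
have /quot_piP Nr := quot_reprK (quot_pi x).
have phi1 : phi 1 = 1 by apply: (mulgI (phi 1)); rewrite -phiM !mulg1.
have phiV y : phi y^-1 = (phi y)^-1.
  by apply: (mulgI (phi y)); rewrite -phiM !mulgV phi1.
by rewrite -phiV -phiM; exact: phiN.
Qed.

Definition quot_mul (x y : quot_group) := quot_pi (repr x * repr y).
Definition quot_inv (x : quot_group) := quot_pi (repr x)^-1.

Lemma quot_mulE x y : quot_mul (quot_pi x) (quot_pi y) = quot_pi (x * y).
Proof.
apply/quot_piP; set x' := repr _; set y' := repr _.
have /quot_piP Nx : quot_pi x' = quot_pi x by exact: quot_reprK.
have /quot_piP Ny : quot_pi y' = quot_pi y by exact: quot_reprK.
have -> : (x' * y')^-1 * (x * y) = (y'^-1 * (x'^-1 * x) * y') * (y'^-1 * y).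
  by rewrite invgM !mulgA mulgK.
by apply: normalM => //; exact: normalJ.
Qed.

Lemma quot_invE x : quot_inv (quot_pi x) = quot_pi x^-1.
Proof.
apply/quot_piP; set x' := repr _.
have /quot_piP Nx : quot_pi x' = quot_pi x by exact: quot_reprK.
have -> : x'^-1^-1 * x^-1 = x'^-1^-1 * (x'^-1 * x)^-1 * x'^-1.
  by rewrite invgM !invgK !mulgA mulgK.
by have /(normalJ x'^-1) := normalV Nx.
Qed.

Lemma quot_mulA : associative quot_mul.
Proof.
move=> x y z; rewrite -(quot_reprK x) -(quot_reprK y) -(quot_reprK z).
by rewrite !quot_mulE mulgA.
Qed.

Lemma quot_mul1 : left_id (quot_pi 1) quot_mul.
Proof. by move=> x; rewrite -(quot_reprK x) quot_mulE mul1g. Qed.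

Lemma quot_mulr1 : right_id (quot_pi 1) quot_mul.
Proof. by move=> x; rewrite -(quot_reprK x) quot_mulE mulg1. Qed.

Lemma quot_mulV : left_inverse (quot_pi 1) quot_inv quot_mul.
Proof. by move=> x; rewrite -(quot_reprK x) quot_invE quot_mulE mulVg. Qed.

Lemma quot_mulrV : right_inverse (quot_pi 1) quot_inv quot_mul.
Proof. by move=> x; rewrite -(quot_reprK x) quot_invE quot_mulE mulgV. Qed.

HB.instance Definition _ := isGroup.Build quot_group
  quot_mulA quot_mul1 quot_mulr1 quot_mulV quot_mulrV.

Lemma quot_piM : {morph quot_pi : x y / x * y}.
Proof. by move=> x y; exact/esym/quot_mulE. Qed.

Definition quot_fixed (tau : G -> G) : set quot_group :=
  [set b | quot_map tau b = b].

(* [x] * b is the class of d^-1 x tau(d) for any lift d of b; the union runs   *)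
(* over all choices of x in the class and of d, so that none is singled out.   *)
Definition H1_act (tau : G -> G) (c : set G) (b : quot_group) : set G :=
  \bigcup_(x in c) \bigcup_(d in quot_pi @^-1` [set b])
    cocycle_class N tau (d^-1 * x * tau d).

(* Orbit of x in a set X of representatives of H^1(N, tau), on which x * b is  *)
(* the element of X whose class is [x] * b.                                    *)
Definition rep_orbit (tau : G -> G) (X : set G) (x : G) : set G :=
  [set y | X y /\ exists2 b, quot_fixed tau b &
     cocycle_class N tau y = H1_act tau (cocycle_class N tau x) b].

End Quotient.

Arguments quot_map {G} N phi y.
Arguments quot_fixed {G} N tau _.
Arguments H1_act {G} N tau c b _.
Arguments rep_orbit {G} N tau X x _.

(* Since the characteristic is zero, a linear algebraic R-group amounts to a   *)
(* subgroup of GL_n(C) cut out by finitely many real polynomials in the matrix *)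
(* entries (denominators 1 / det can be cleared).                              *)
Section Locus.
Variables (R : realType) (n : nat).

Definition GL_locus (eqs : seq (mpoly (n * n) R)) : pred 'M[R[i]]_n :=
  fun A => (A \in unitmx) &&
    all (fun p => mmap (real_complex R) (fun k => mxvec A 0%R k) p == 0%R) eqs.

End Locus.

Record linAlgGroup (R : realType) := LinAlgGroup {
  lag_dim : nat;
  lag_eqs : seq (mpoly (lag_dim * lag_dim) R);
  lag1 : GL_locus lag_eqs 1%:M%R;
  lagM : forall A B, GL_locus lag_eqs A -> GL_locus lag_eqs B ->
    GL_locus lag_eqs (A *m B)%R;
  lagV : forall A, GL_locus lag_eqs A -> GL_locus lag_eqs (invmx A)
}.

Section Points.
Variables (R : realType) (GG : linAlgGroup R).
Local Notation n := (lag_dim GG).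

Record points := Points {
  point_mx :> 'M[R[i]]_n;
  pointP : GL_locus (lag_eqs GG) point_mx
}.

HB.instance Definition _ := [isSub for point_mx].
HB.instance Definition _ := [Choice of points by <:].

Definition point_one := Points (lag1 GG).
Definition point_mul (x y : points) := Points (lagM (pointP x) (pointP y)).
Definition point_inv (x : points) := Points (lagV (pointP x)).

Lemma point_unit (x : points) : point_mx x \in unitmx.
Proof. by have /andP[] := pointP x. Qed.

Lemma point_mulA : associative point_mul.
Proof. by move=> x y z; apply: val_inj; rewrite /= mulmxA. Qed.

Lemma point_mul1 : left_id point_one point_mul.
Proof. by move=> x; apply: val_inj; rewrite /= mul1mx. Qed.

Lemma point_mulr1 : right_id point_one point_mul.
Proof. by move=> x; apply: val_inj; rewrite /= mulmx1. Qed.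

Lemma point_mulV : left_inverse point_one point_inv point_mul.
Proof. by move=> x; apply: val_inj; rewrite /= mulVmx // point_unit. Qed.

Lemma point_mulrV : right_inverse point_one point_inv point_mul.
Proof. by move=> x; apply: val_inj; rewrite /= mulmxV // point_unit. Qed.

HB.instance Definition _ := isGroup.Build points
  point_mulA point_mul1 point_mulr1 point_mulV point_mulrV.

Definition point_eval (p : mpoly (n * n) R[i]) (x : points) : R[i] :=
  meval (fun k => mxvec (point_mx x) 0%R k) p.

Definition zariski_open (U : set points) : Prop :=
  exists P : set (mpoly (n * n) R[i]),
    U = [set x | exists2 p, P p & point_eval p x <> 0%R].

Lemma zariski_openT : zariski_open setT.
Proof.
exists [set 1%R]; apply/esym/seteqP; split=> // x _; exists 1%R => //.
by rewrite /point_eval meval1; apply/eqP; exact: oner_neq0.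
Qed.

Lemma zariski_openI : setI_closed zariski_open.
Proof.
move=> U V [P ->] [Q ->].
exists [set r | exists p q, [/\ P p, Q q & r = (p * q)%R]].
apply/seteqP; split=> x /=.
  move=> [[p Pp px] [q Qq qx]]; exists (p * q)%R; first by exists p, q.
  rewrite /point_eval mevalM; apply/eqP.
  by rewrite mulf_neq0 //; apply/eqP.
move=> [_ [p [q [Pp Qq ->]]]]; rewrite /point_eval mevalM => pq.
by split; [exists p|exists q] => // e; apply: pq; move: e; rewrite /point_eval => ->;
  rewrite ?mul0r ?mulr0.
Qed.

Lemma zariski_open_bigU (I : Type) (f : I -> set points) :
  (forall i, zariski_open (f i)) -> zariski_open (\bigcup_i f i).
Proof.
move=> fo; exists [set p | exists2 i, True &
  (forall x, point_eval p x <> 0%R -> f i x)].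
apply/seteqP; split=> x /=.
  move=> [i _ fx]; have [P fE] := fo i; move: (fx); rewrite fE => -[p Pp px].
  by exists p => //; exists i => // y py; rewrite fE; exists p.
by move=> [p [i _ pf] px]; exists i => //; exact: pf.
Qed.

HB.instance Definition _ := isOpenTopological.Build points
  zariski_openT zariski_openI zariski_open_bigU.

Lemma zariski_openE (U : set points) : open U = zariski_open U.
Proof. by []. Qed.

Definition identity_component_set : set points :=
  connected_component [set: points] 1.

Lemma continuous_evalP (f : points -> points) :
    (forall p, exists q, forall x,
       point_eval p (f x) <> 0%R <-> point_eval q x <> 0%R) ->
  continuous f.
Proof.
move=> fp; apply/continuousP => A; rewrite !zariski_openE => -[P ->].
exists [set q | exists2 p, P p &
  forall x, point_eval p (f x) <> 0%R <-> point_eval q x <> 0%R].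
apply/seteqP; split=> x /=.
  by move=> [p Pp px]; have [q pq] := fp p; exists q; [exists p|apply/pq].
by move=> [q [p Pp pq] /pq px]; exists p.
Qed.

Lemma continuous_linear (f : points -> points)
    (M : 'I_(n * n) -> mpoly (n * n) R[i]) :
    (forall x k, mxvec (point_mx (f x)) 0%R k = point_eval (M k) x) ->
  continuous f.
Proof.
move=> fM; apply: continuous_evalP => p.
exists (comp_mpoly [tuple M k | k < n * n] p) => x.
suff -> : point_eval p (f x) =
  point_eval (comp_mpoly [tuple M k | k < n * n] p) x by [].
rewrite /point_eval comp_mpoly_meval; apply: meval_eq => k.
by rewrite tnth_mktuple fM.
Qed.

Definition coord_poly (i j : 'I_n) : mpoly (n * n) R[i] :=
  mpolyX R[i] (mnm1 (mxvec_index i j)).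

Lemma coord_polyE i j x : point_eval (coord_poly i j) x = point_mx x i j.
Proof. by rewrite /point_eval mevalXU mxvecE. Qed.

Lemma continuous_mulgl (a : points) : continuous ((fun x => a * x) : points -> points).
Proof.
pose Mm (i j : 'I_n) : mpoly (n * n) R[i] :=
  (\sum_k point_mx a i k *: coord_poly k j)%R.
apply: (@continuous_linear _ (fun k => mxvec (\matrix_(i, j) Mm i j)%R 0%R k)).
move=> x k; case/mxvec_indexP: k => i j; rewrite !mxvecE !mxE.
rewrite /point_eval raddf_sum /=; apply: eq_bigr => k _.
by rewrite mevalZ -/(point_eval _ _) coord_polyE.
Qed.

Lemma continuous_mulgr (a : points) : continuous ((fun x => x * a) : points -> points).
Proof.
pose Mm (i j : 'I_n) : mpoly (n * n) R[i] :=
  (\sum_k point_mx a k j *: coord_poly i k)%R.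
apply: (@continuous_linear _ (fun k => mxvec (\matrix_(i, j) Mm i j)%R 0%R k)).
move=> x k; case/mxvec_indexP: k => i j; rewrite !mxvecE !mxE.
rewrite /point_eval raddf_sum /=; apply: eq_bigr => k _.
by rewrite mevalZ -/(point_eval _ _) coord_polyE mulrC.
Qed.

Lemma identity_component1 : identity_component_set 1.
Proof. exact: connected_component_refl. Qed.

Lemma identity_component_image (f : points -> points) (a : points) :
    continuous f -> identity_component_set a -> f a = 1 ->
  forall x, identity_component_set x -> identity_component_set (f x).
Proof.
move=> fc Ga fa x Gx.
have sub : f @` identity_component_set `<=` identity_component_set.
  apply: connected_component_max => //; first by exists a.
  apply: connected_continuous_connected; first exact: component_connected.
  exact: continuous_subspaceT.
by apply: sub; exists x.
Qed.

Lemma identity_componentVM x y : identity_component_set x ->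
  identity_component_set y -> identity_component_set (x^-1 * y).
Proof.
move=> Gx; apply: (identity_component_image (@continuous_mulgl x^-1) Gx).
exact: mulVg.
Qed.

Lemma identity_componentJ x y : identity_component_set x ->
  identity_component_set (y^-1 * x * y).
Proof.
apply: (@identity_component_image (fun x => y^-1 * x * y) 1).
- move=> z; apply: (@continuous_comp _ _ _ (fun x => y^-1 * x) (fun x => x * y)).
    exact: continuous_mulgl.
  exact: continuous_mulgr.
- exact: identity_component1.
- by rewrite mulg1 mulVg.
Qed.

Definition identity_component : normalSubgroup points :=
  NormalSubgroup identity_component1 identity_componentVM identity_componentJ.

Definition component_group := quot_group identity_component.

HB.instance Definition _ := Group.on component_group.

Lemma conj_mxvec (A : 'M[R[i]]_n) k :
  mxvec (map_mx conjc A) 0%R k = conjc (mxvec A 0%R k).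
Proof. by case/mxvec_indexP: k => i j; rewrite !mxvecE mxE. Qed.

Lemma conj_locus (A : 'M[R[i]]_n) :
  GL_locus (lag_eqs GG) A -> GL_locus (lag_eqs GG) (map_mx conjc A).
Proof.
move=> /andP[Au /allP Ap]; apply/andP; split; first by rewrite map_unitmx.
apply/allP => p /Ap /eqP pA0; apply/eqP.
rewrite -[RHS]conjc0 -pA0 /mmap rmorph_sum /=; apply: eq_bigr => m _.
rewrite rmorphM /mmap1 rmorph_prod /=; congr (_ * _)%R.
  by rewrite oppr0.
by apply: eq_bigr => k _; rewrite rmorphXn /= conj_mxvec.
Qed.

Definition sigma (x : points) : points := Points (conj_locus (pointP x)).

Lemma sigmaM : {morph sigma : x y / x * y}.
Proof. by move=> x y; apply: val_inj; rewrite /= map_mxM. Qed.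

Lemma sigmaK : involutive sigma.
Proof.
by move=> x; apply: val_inj; apply/matrixP => i j; rewrite /= !mxE conjcK.
Qed.

Lemma continuous_sigma : continuous sigma.
Proof.
apply: continuous_evalP => p; exists (map_mpoly conjc p) => x.
suff -> : point_eval p (sigma x) = conjc (point_eval (map_mpoly conjc p) x).
  by split=> /eqP; rewrite ?conjc_eq0 => px; apply/eqP; rewrite ?conjc_eq0.
have mapE h : meval h (map_mpoly conjc p) =
    (\sum_(m <- msupp p) conjc (mcoeff m p) * \prod_(i < n * n) h i ^+ m i)%R.
  rewrite /map_mpoly [X in meval _ X]/mmap rmorph_sum /=.
  by apply: eq_bigr => m _; rewrite mmap1_id rmorphM /= mevalC mevalX.
rewrite /point_eval mapE mevalE rmorph_sum /=; apply: eq_bigr => m _.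
rewrite rmorphM /= conjcK rmorph_prod; congr (_ * _)%R.
by apply: eq_bigr => k _; rewrite rmorphXn /= conj_mxvec.
Qed.

Lemma sigma_component x :
  identity_component_set x -> identity_component_set (sigma x).
Proof.
apply: (identity_component_image continuous_sigma identity_component1).
by apply: val_inj; rewrite /= map_mx1.
Qed.

Definition component_pi : points -> component_group :=
  quot_pi identity_component.

Definition component_sigma : component_group -> component_group :=
  quot_map identity_component sigma.

Lemma component_sigmaE x :
  component_sigma (component_pi x) = component_pi (sigma x).
Proof. by apply: quot_mapE => //; [exact: sigmaM|exact: sigma_component]. Qed.

Definition H1R : set (set points) := H1 [set: points] sigma.

End Points.

Arguments component_pi {R GG} x.
Arguments component_sigma {R GG} y.
Arguments sigma {R GG} x.
Arguments identity_component {R} GG.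
Arguments H1R {R} GG.

(* Main.v *)
(** By twisting, x |-> x g_i identifies the cocycles of (G, sigma) lying over
    g_i^f with Z^1(G^0, sigma_i).  Two such cocycles are equivalent in G exactly
    when their sources differ by c x sigma_i(c)^-1 for some c in G, and such a c
    automatically has a sigma_i-fixed image in G / G^0; so the classes of
    H^1(G, sigma) over [g_i^f] are the orbits of the fixed points of sigma_i in
    G / G^0 on H^1(G^0, sigma_i).  The set I consists of the i for which g_i^f
    lifts to a cocycle of G. *)

Require Import Defs.
From mathcomp Require Import all_boot.
From mathcomp Require Import classical_sets functions reals.

Local Open Scope classical_set_scope.
Local Open Scope group_scope.

(** * Multiplicative maps and equality of cocycle classes *)

Section GroupMorphism.
Context {G : groupType} {phi : G -> G}.
Hypothesis phiM : {morph phi : x y / x * y}.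

Lemma morph_mulg1 : phi 1 = 1.
Proof. by apply: (mulgI (phi 1)); rewrite -phiM !mulg1. Qed.

Lemma morph_invg x : phi x^-1 = (phi x)^-1.
Proof. by apply: (mulgI (phi x)); rewrite -phiM !mulgV morph_mulg1. Qed.

End GroupMorphism.

Lemma full_subgroupVM (G : groupType) (x y : G) :
  [set: G] x -> [set: G] y -> [set: G] (x^-1 * y).
Proof. by []. Qed.

Lemma full_subgroupJ (G : groupType) (x y : G) :
  [set: G] x -> [set: G] (y^-1 * x * y).
Proof. by []. Qed.

(** Packages a whole group so that [cocycle_class_eqP], stated for normal subgroups, also covers the
    cohomology of G and of G / N. *)
Definition full_subgroup (G : groupType) : normalSubgroup G :=
  @NormalSubgroup G [set: G] I (@full_subgroupVM G) (@full_subgroupJ G).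

(** As [tau] is multiplicative, [A] acts by sending a to c a tau(c)^-1; classes are orbits of this
    action, and orbits that meet coincide. *)
Lemma cocycle_class_eqP {G : groupType} {A : normalSubgroup G} {tau : G -> G}
    (tauM : {morph tau : x y / x * y}) {a b : G} :
  cocycle_class A tau a = cocycle_class A tau b <->
  exists2 c, normal_set A c & b = c * a * (tau c)^-1.
Proof.
split=> [ab|[c Ac ->]].
  suff: cocycle_class A tau a b by [].
  rewrite ab; exists 1; first exact: normal1.
  by rewrite (morph_mulg1 tauM) invg1 mulg1 mul1g.
apply/seteqP; split=> _ [d Ad ->].
  exists (d * c^-1); first by apply: normalM => //; exact: normalV.
  by rewrite tauM (morph_invg tauM) !(invgM, invgK, mulgA, mulgVK).
exists (d * c); first exact: normalM.
by rewrite tauM !(invgM, invgK, mulgA).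
Qed.

(** * Fixed points of the quotient acting on the cohomology of [N] *)

Section NormalAction.
Context {G : groupType} {N : normalSubgroup G} {tau : G -> G}.
Hypotheses (tauM : {morph tau : x y / x * y}) (tauK : involutive tau).
Hypothesis tauN : forall x, normal_set N x -> normal_set N (tau x).

Lemma normalJV {x} y : normal_set N x -> normal_set N (y * x * y^-1).
Proof. by move=> /(normalJ y^-1); rewrite invgK. Qed.

Lemma quot_map_involutive : involutive (quot_map N tau).
Proof. by move=> y; rewrite -(quot_reprK y) !quot_mapE // tauK. Qed.

Lemma quot_fixedP b :
  quot_fixed N tau (quot_pi N b) <-> normal_set N (b^-1 * tau b).
Proof.
rewrite /quot_fixed /= quot_mapE //; split.
  by move=> /esym/quot_piP.
by move=> /quot_piP.
Qed.

Lemma Z1_act x b : Z1 N tau x -> quot_fixed N tau (quot_pi N b) ->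
  Z1 N tau (b^-1 * x * tau b).
Proof.
move=> [Nx xx] /quot_fixedP Nb; split.
  (* The first factor is in [N] by normality, the second because the coset of [b] is fixed. *)
  have -> : b^-1 * x * tau b = b^-1 * x * b * (b^-1 * tau b).
    by rewrite !mulgA mulgK.
  by apply: normalM => //; exact: normalJ.
rewrite !tauM (morph_invg tauM) tauK !mulgA mulgK -[b^-1 * x * _]mulgA xx.
by rewrite mulg1 mulVg.
Qed.

(** Neither the lift nor the chosen member of the class affects the result, so the union defining
    [H1_act] collapses to a single class. *)
Lemma H1_act_class x b :
  H1_act N tau (cocycle_class N tau x) (quot_pi N b) =
  cocycle_class N tau (b^-1 * x * tau b).
Proof.
have class_lift y d : cocycle_class N tau x y -> quot_pi N d = quot_pi N b ->
    cocycle_class N tau (d^-1 * y * tau d) =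
    cocycle_class N tau (b^-1 * x * tau b).
  move=> [c Nc ->] /quot_piP Ndb; apply/esym/cocycle_class_eqP => //.
  (* The conjugator is d^-1 c b, split into two factors visibly in [N]. *)
  exists (d^-1 * b * (b^-1 * c * b)).
    by apply: normalM => //; exact: normalJ.
  by rewrite !tauM !(morph_invg tauM) !(invgM, invgK, mulgA, mulgK, mulgVK).
apply/seteqP; split=> [z [y yx [d db dz]]|z bz].
  by rewrite -(class_lift y d).
exists x; last by exists b.
exists 1; first exact: normal1.
by rewrite (morph_mulg1 tauM) invg1 mulg1 mul1g.
Qed.

Lemma H1_act1 c : H1 N tau c -> H1_act N tau c 1 = c.
Proof.
move=> [x _ <-]; rewrite (H1_act_class x 1).
by rewrite (morph_mulg1 tauM) invg1 mulg1 mul1g.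
Qed.

Lemma H1_actM c b b' : H1 N tau c ->
  H1_act N tau (H1_act N tau c b) b' = H1_act N tau c (b * b').
Proof.
move=> [x _ <-]; rewrite -(quot_reprK b) -(quot_reprK b') -quot_piM.
by rewrite !H1_act_class tauM invgM !mulgA.
Qed.

(** Modulo [N] both x and c x tau(c)^-1 vanish, hence c and tau(c) agree there. So equivalences in G
    between [N]-valued cocycles come from fixed points. *)
Lemma equiv_lift_fixed x c :
  normal_set N x -> normal_set N (c * x * (tau c)^-1) ->
  quot_fixed N tau (quot_pi N c).
Proof.
move=> Nx Ny; apply/quot_fixedP; set y := c * x * _ in Ny.
have -> : c^-1 * tau c = c^-1 * y^-1 * c * x.
  by rewrite /y !(invgM, invgK, mulgA, mulgVK).
by apply: normalM => //; apply: normalJ; exact: normalV.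
Qed.

(** Frees orbits from the fixed-point condition, which [equiv_lift_fixed] makes automatic; orbits
    can then be compared with equivalence in G. *)
Lemma rep_orbitP {X : set G} {x z} : X `<=` Z1 N tau -> X x ->
  rep_orbit N tau X x z <-> X z /\ exists c, z = c * x * (tau c)^-1.
Proof.
move=> XZ Xx; split=> [[Xz [b bfix]]|[Xz [c zE]]].
  rewrite -(quot_reprK b) H1_act_class; set d := repr _.
  move=> /esym/(cocycle_class_eqP tauM) [n Nn zE]; split=> //.
  exists (n * d^-1); rewrite zE.
  by rewrite tauM (morph_invg tauM) !(invgM, invgK, mulgA).
(* The right action of b uses b^-1 on the left, so c acts through the image of its inverse. *)
split=> //; exists (quot_pi N c^-1).
  have [[Nx _] [Nz _]] := (XZ _ Xx, XZ _ Xz).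
  apply: (@equiv_lift_fixed z) => //.
  by rewrite zE (morph_invg tauM) !(invgK, mulgA, mulVg, mul1g, mulgVK).
by rewrite H1_act_class zE (morph_invg tauM) invgK.
Qed.

Lemma rep_orbit_eqP {X : set G} {x y} : X `<=` Z1 N tau -> X x -> X y ->
  rep_orbit N tau X x = rep_orbit N tau X y <->
  exists c, y = c * x * (tau c)^-1.
Proof.
move=> XZ Xx Xy; split=> [xy|[c yE]].
  have /rep_orbitP[] // : rep_orbit N tau X x y.
  rewrite xy; apply/rep_orbitP => //; split=> //; exists 1.
  by rewrite (morph_mulg1 tauM) invg1 mulg1 mul1g.
apply/seteqP; split=> z /rep_orbitP[] // Xz [d zE]; apply/rep_orbitP => //.
  split=> //; exists (d * c^-1).
  by rewrite zE yE tauM (morph_invg tauM) !(invgM, invgK, mulgA, mulgVK).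
by split=> //; exists (d * c); rewrite zE yE tauM !(invgM, mulgA).
Qed.

End NormalAction.

(** * Twisting an involution by a cocycle *)

Section Twist.
Context {G : groupType} {sigma : G -> G}.
Hypotheses (sigmaM : {morph sigma : x y / x * y}) (sigmaK : involutive sigma).

Definition twist (g x : G) : G := g * sigma x * g^-1.

Lemma twistM g : {morph twist g : x y / x * y}.
Proof. by move=> x y; rewrite /twist sigmaM !mulgA mulgVK. Qed.

(** The square of the twist is conjugation by g sigma(g), which is 1 for a cocycle. *)
Lemma twistK g : Z1 [set: G] sigma g -> involutive (twist g).
Proof.
move=> [_ gg] x; rewrite /twist !sigmaM (morph_invg sigmaM) sigmaK !mulgA gg.
by rewrite mul1g -mulgA -invgM gg invg1 mulg1.
Qed.

Lemma twist_normal (N : normalSubgroup G) g x :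
  (forall y, normal_set N y -> normal_set N (sigma y)) ->
  normal_set N x -> normal_set N (twist g x).
Proof. by move=> sigmaN Nx; apply: normalJV; exact: sigmaN. Qed.

(** Right translation by g intertwines twisted and untwisted equivalence. *)
Lemma twist_equiv g x c :
  c * (x * g) * (sigma c)^-1 = c * x * (twist g c)^-1 * g.
Proof. by rewrite /twist !(invgM, invgK, mulgA, mulgVK). Qed.

Lemma twist_cocycle g x : g * sigma g = 1 ->
  x * g * sigma (x * g) = x * twist g x.
Proof.
move=> /(canRL (mulKg _)); rewrite mulg1 => sg.
by rewrite /twist sigmaM sg !mulgA.
Qed.

(** The right-hand side is the expression s f(s) a whose triviality defines [I]; hence that
    condition says that s h is a cocycle. *)
Lemma lift_cocycle s h :
  s * h * sigma (s * h) = s * (h * sigma s * h^-1) * (h * sigma h).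
Proof. by rewrite sigmaM !mulgA mulgVK. Qed.

End Twist.

Lemma quot_pi_mull (G : groupType) (N : normalSubgroup G) x y :
  normal_set N x -> quot_pi N (x * y) = quot_pi N y.
Proof.
move=> Nx; apply/esym/quot_piP.
by rewrite mulgA; exact: normalJ.
Qed.

Lemma quot_pi_normal (G : groupType) (N : normalSubgroup G) x y :
  quot_pi N x = quot_pi N y -> normal_set N (x * y^-1).
Proof.
move=> /esym/quot_piP /(normalJV y).
by rewrite !mulgA mulgV mul1g.
Qed.

(** * Representatives for an abstract group with a normal subgroup *)

Section Representatives.
Context {G : groupType} {N : normalSubgroup G} {sigma : G -> G}.
Hypotheses (sigmaM : {morph sigma : x y / x * y}) (sigmaK : involutive sigma).
Hypothesis sigmaN : forall x, normal_set N x -> normal_set N (sigma x).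

Local Notation sigmaf := (quot_map N sigma).
Local Notation tw := (@twist G sigma).

Lemma quot_mapM : {morph sigmaf : x y / x * y}.
Proof.
move=> x y; rewrite -(quot_reprK x) -(quot_reprK y) -quot_piM !quot_mapE //.
by rewrite sigmaM quot_piM.
Qed.

Lemma quot_piV x : quot_pi N x^-1 = (quot_pi N x)^-1.
Proof. exact/esym/quot_invE. Qed.

Lemma lift_cocycle_normal h :
  Z1 [set: quot_group N] sigmaf (quot_pi N h) -> normal_set N (h * sigma h).
Proof.
move=> [_]; rewrite quot_mapE // -quot_piM.
by move=> /esym/quot_piP; rewrite invg1 mul1g.
Qed.

(** The image of a in G / N is a cocycle, hence equivalent to some [gf i]; lifting the conjugator to
    G moves a itself over [gf i]. *)
Lemma cocycle_over_representative {J : Type} {gf : J -> quot_group N} :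
    H1 [set: quot_group N] sigmaf `<=`
      range (fun i => cocycle_class [set: quot_group N] sigmaf (gf i)) ->
  forall a, Z1 [set: G] sigma a ->
  exists i c, quot_pi N (c * a * (sigma c)^-1) = gf i.
Proof.
move=> surj a [_ aa].
have /surj [i _] : H1 [set: quot_group N] sigmaf
    (cocycle_class [set: quot_group N] sigmaf (quot_pi N a)).
  exists (quot_pi N a) => //; split=> //.
  by rewrite quot_mapE // -quot_piM aa.
move=> /esym/(cocycle_class_eqP (A := full_subgroup _) quot_mapM) [c _ giE].
exists i, (repr c); rewrite giE !quot_piM quot_piV -quot_mapE //.
by rewrite quot_reprK.
Qed.

Lemma Z1_equiv {a} c :
  Z1 [set: G] sigma a -> Z1 [set: G] sigma (c * a * (sigma c)^-1).
Proof.
move=> [_ aa]; split=> //.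
rewrite !sigmaM (morph_invg sigmaM) sigmaK !mulgA mulgVK -[c * a * _]mulgA aa.
by rewrite mulg1 mulgV.
Qed.

(** The purely group-theoretic form of the result. The second hypothesis says that [I] misses no
    index over which a cocycle of G lies. *)
Lemma representatives_union {J : Type} {gf : J -> quot_group N} {I : set J}
    {g : J -> G} {X Xs : J -> set G} :
    set_bij [set: J] (H1 [set: quot_group N] sigmaf)
      (fun i => cocycle_class [set: quot_group N] sigmaf (gf i)) ->
    (forall i a, Z1 [set: G] sigma a -> quot_pi N a = gf i -> I i) ->
    (forall i, I i -> Z1 [set: G] sigma (g i)) ->
    (forall i, I i -> quot_pi N (g i) = gf i) ->
    (forall i, I i -> represents_H1 N (tw (g i)) (X i)) ->
    (forall i, I i -> Xs i `<=` X i /\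
       set_bij (Xs i) [set rep_orbit N (tw (g i)) (X i) x | x in X i]
         (rep_orbit N (tw (g i)) (X i))) ->
  represents_H1 [set: G] sigma (\bigcup_(i in I) [set x * g i | x in Xs i]).
Proof.
move=> [_ gf_inj gf_surj] Imax gZ g_lift Xrep Xsrep.
have twN i x : normal_set N x -> normal_set N (tw (g i) x).
  exact: twist_normal.
have XZ i : I i -> X i `<=` Z1 N (tw (g i)) by move=> /Xrep[].
have XsX i : I i -> Xs i `<=` X i by move=> /Xsrep[].
have XsN i x : I i -> Xs i x -> quot_pi N (x * g i) = gf i.
  move=> Ii /(XsX i Ii)/(XZ i Ii)[Nx _].
  by rewrite quot_pi_mull // g_lift.
have XXZ : \bigcup_(i in I) [set x * g i | x in Xs i] `<=` Z1 [set: G] sigma.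
  move=> _ [i Ii [x Xsx <-]]; split=> //.
  have [_ gg] := gZ i Ii; have [_ xx] := XZ i Ii _ (XsX i Ii _ Xsx).
  by rewrite twist_cocycle.
split=> //; split=> [a /XXZ Za|a b|_ [a Za <-]]; first by exists a.
  rewrite !inE => -[i Ii [x Xsx <-]] [j Ij [y Xsy <-]].
  move=> /(cocycle_class_eqP (A := full_subgroup _) sigmaM) [c _ xy].
  (* Projecting the equivalence to G / N makes [gf i] and [gf j] equivalent. *)
  have ij : i = j.
    apply: gf_inj; rewrite ?inE //.
    apply/(cocycle_class_eqP (A := full_subgroup _) quot_mapM).
    exists (quot_pi N c) => //; rewrite -(XsN j y) // xy !quot_piM quot_piV.
    by rewrite -quot_piM XsN // quot_mapE.
  (* Within one fibre, cancelling [g i] puts x and y in one orbit, which has a single representative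
     in [Xs i]. *)
  subst j; congr (_ * _).
  have [_ [_ orb_inj _]] := Xsrep i Ii.
  apply: orb_inj; rewrite ?inE //.
  apply/(rep_orbit_eqP (twistM sigmaM _) (twN i)); [exact: XZ|exact: XsX..|].
  by exists c; apply: (mulIg (g i)); rewrite xy twist_equiv.
(* Surjectivity: move a to b over some [gf i], untwist b, then pass to its representative x in [X i]
   and to the orbit representative y in [Xs i]. *)
have [i [c]] := cocycle_over_representative gf_surj a Za.
have := Z1_equiv c Za; set b := c * a * _ => Zb bi.
have Ii := Imax i b Zb bi.
have ZN : Z1 N (tw (g i)) (b * (g i)^-1).
  have [_ gg] := gZ i Ii; have [_ bb] := Zb; split.
    by apply: quot_pi_normal; rewrite bi g_lift.
  by rewrite -twist_cocycle // mulgVK.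
have [_ [_ _ X_surj]] := Xrep i Ii.
have /X_surj [x Xx /(cocycle_class_eqP (twistM sigmaM _)) [d _ bE]] :
    H1 N (tw (g i)) (cocycle_class N (tw (g i)) (b * (g i)^-1)).
  by exists (b * (g i)^-1).
have [_ [_ _ orb_surj]] := Xsrep i Ii.
have /orb_surj [y Xsy] : [set rep_orbit N (tw (g i)) (X i) x | x in X i]
    (rep_orbit N (tw (g i)) (X i) x) by exists x.
move=> /(rep_orbit_eqP (twistM sigmaM _) (twN i) (XZ i Ii) (XsX i Ii _ Xsy) Xx).
move=> [e xE].
exists (y * g i); first by exists i => //; exists y.
apply/(cocycle_class_eqP (A := full_subgroup _) sigmaM).
(* From right to left: e takes y to x, d takes x to the untwisted b, and c^-1 returns from b to
   a. *)
exists (c^-1 * d * e) => //.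
have {bE}bE : b = d * x * (tw (g i) d)^-1 * g i by rewrite -bE mulgVK.
have aE : a = c^-1 * b * (sigma c^-1)^-1.
  by rewrite /b (morph_invg sigmaM) invgK !mulgA mulgVK mulVg mul1g.
rewrite aE bE xE /twist !sigmaM !(morph_invg sigmaM).
by rewrite !(invgM, invgK, mulgA, mulgVK).
Qed.

End Representatives.

(** * Complex points with conjugation and the identity component *)

Theorem mainTheorem1 (R : realType) (GG : linAlgGroup R)
  (k : nat) (gf : 'I_k.+1 -> component_group GG)
  (gf1 : gf ord0 = 1)
  (gfZ : forall i, Z1 [set: component_group GG] component_sigma (gf i))
  (gf_reps : set_bij [set: 'I_k.+1]
     (H1 [set: component_group GG] component_sigma)
     (fun i => cocycle_class [set: component_group GG] component_sigma (gf i)))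
  (h : 'I_k.+1 -> points GG)
  (h_lift : forall i, component_pi (h i) = gf i) :
  let G0 : set (points GG) := identity_component GG in
  let a i := h i * sigma (h i) in
  let f i x := h i * sigma x * (h i)^-1 in
  let I : set 'I_k.+1 := [set i | exists2 s, G0 s & s * f i s * a i = 1] in
  (forall i, G0 (a i)) /\
  (forall i x, G0 x -> G0 (f i x)) /\
  forall s : 'I_k.+1 -> points GG,
  (forall i, I i -> G0 (s i) /\ s i * f i (s i) * a i = 1) ->
  let g i := s i * h i in
  let sigma_ i x := g i * sigma x * (g i)^-1 in
  let sigmaf_ i := quot_map (identity_component GG) (sigma_ i) in
  let act i := H1_act (identity_component GG) (sigma_ i) in
  let fixed i := quot_fixed (identity_component GG) (sigma_ i) in
  (forall i, I i ->
    [/\ Z1 [set: points GG] sigma (g i),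
        component_pi (g i) = gf i,
        {morph sigma_ i : x y / x * y} /\ involutive (sigma_ i),
        forall x, G0 x -> G0 (sigma_ i x)
      & (forall x, sigmaf_ i (component_pi x) = component_pi (sigma_ i x)) /\
        involutive (sigmaf_ i)]) /\
  (forall i, I i ->
    [/\ forall x b, Z1 G0 (sigma_ i) x -> fixed i (component_pi b) ->
          Z1 G0 (sigma_ i) (b^-1 * x * sigma_ i b) /\
          act i (cocycle_class G0 (sigma_ i) x) (component_pi b) =
            cocycle_class G0 (sigma_ i) (b^-1 * x * sigma_ i b),
        forall c, H1 G0 (sigma_ i) c -> act i c 1 = c
      & forall c b b', H1 G0 (sigma_ i) c -> fixed i b -> fixed i b' ->
          act i (act i c b) b' = act i c (b * b')]) /\
  forall X Xs : 'I_k.+1 -> set (points GG),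
  (forall i, I i -> represents_H1 G0 (sigma_ i) (X i)) ->
  (forall i, I i -> Xs i `<=` X i /\
     set_bij (Xs i)
       [set rep_orbit (identity_component GG) (sigma_ i) (X i) x | x in X i]
       (rep_orbit (identity_component GG) (sigma_ i) (X i))) ->
  let XX := \bigcup_(i in I) [set x * g i | x in Xs i] in
  XX `<=` Z1 [set: points GG] sigma /\
  set_bij XX (H1R GG) (cocycle_class [set: points GG] sigma).
Proof.
move=> G0 a f I.
have sigmaN x : G0 x -> G0 (sigma x) by exact: sigma_component.
split=> [i|].
  apply: (lift_cocycle_normal (@sigmaM R GG) sigmaN).
  by have := gfZ i; rewrite -h_lift.
split=> [i x Gx|s sI g sigma_ sigmaf_ act fixed].
  exact: (twist_normal _ _ _ sigmaN).
have gZ i : I i -> Z1 [set: points GG] sigma (g i).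
  by move=> /sI[_ sfa]; split=> //; rewrite (lift_cocycle (@sigmaM R GG)).
have g_lift i : I i -> component_pi (g i) = gf i.
  by move=> /sI[Gs _]; rewrite -h_lift; exact: quot_pi_mull.
have twM i := twistM (@sigmaM R GG) (g i).
have twK i (Ii : I i) := twistK (@sigmaM R GG) (@sigmaK R GG) _ (gZ i Ii).
have twN i x : G0 x -> G0 (sigma_ i x).
  exact: (twist_normal _ _ _ sigmaN).
split=> [i Ii|].
  split; [exact: gZ|exact: g_lift| |exact: twN|].
    by split; [exact: twM|exact: twK].
  split=> [x|]; first exact: (quot_mapE (twM i) (twN i)).
  exact: (quot_map_involutive (twM i) (twK i Ii) (twN i)).
split=> [i Ii|X Xs Xrep Xsrep].
  split=> [x b xZ bfix|c cH|c b b' cH _ _].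
  - split; first exact: (Z1_act (twM i) (twK i Ii) (twN i)).
    exact: (H1_act_class (twM i)).
  - exact: (H1_act1 (twM i)).
  - exact: (H1_actM (twM i)).
apply: (representatives_union (@sigmaM R GG) (@sigmaK R GG)
  sigmaN gf_reps _ gZ g_lift Xrep Xsrep).
(* Any cocycle b over [gf i] is s h_i with s = b h_i^-1 in [G0], so [lift_cocycle] yields the
   equation defining [I]. *)
move=> i b [_ bb] bi; exists (b * (h i)^-1).
  by apply: quot_pi_normal; rewrite bi -h_lift.
by rewrite /f /a -(lift_cocycle (@sigmaM R GG)) mulgVK.
Qed.
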